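(* Let $n\geq 19$ be an integer and set $\lambda_n=\dfrac{n(n-4)}{4(n-1)}$. There does not exist a real-valued function $f\in\mathcal C^1([0,1/2))$ with $f(0)=0$ such that $$f'(s)\geq \lambda_n-\frac{n}{2(1-2s)}\bigl(2s-f(s)^2\bigr)\qquad\text{for all } s\in[0,1/2).$$
   Context: $\mathcal C^1([0,1/2))$ denotes the continuously differentiable real-valued functions on the half-open interval $[0,1/2)$, with the derivative at $0$ understood as one-sided. *)

(* Defs.v *)
From Stdlib Require Import Reals.
Open Scope R_scope.

Definition half_open_half (s : R) : Prop := 0 <= s < 1/2.

(* [f] is continuously differentiable on [D], with derivative [df]. [D_in] and
   [continue_in] take limits along points of [D] only, hence are one-sided at an
   endpoint of an interval. Values of [f] and [df] outside [D] are irrelevant;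
   if [D] is a nondegenerate interval, [df] is determined on [D] by [f]. *)
Definition C1_on (D : R -> Prop) (f df : R -> R) : Prop :=
  (forall s, D s -> D_in f df D s) /\ (forall s, D s -> continue_in df D s).

Definition lambda (n : nat) : R :=
  INR n * (INR n - 4) / (4 * (INR n - 1)).

(* Main.v *)
Require Import Defs.
From Stdlib Require Import Reals.
From Stdlib Require Import Lra.
From Coquelicot Require Import Coquelicot.
Open Scope R_scope.

(** The differential inequality is a Riccati inequality [h' >= q + p h^2] with
    [p > 0].  A solution with [h = 0] at the left end of an interval forces the
    quadratic form [phi |-> ∫ (phi'^2 / p - q phi^2)] to be nonnegative on the
    functions vanishing at the right end, so one test function at which the form
    is negative rules such a solution out.  In the form used here
    ([riccati_test_function]) no integral is needed: if [Q] is an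
    antiderivative of [q phi^2 - phi'^2 / p], then [phi^2 h - Q] is nondecreasing, because its derivative is at least the
    nonnegative quantity [p (phi h + phi' / p)^2].

    A single test function serves every [n >= 19].  The rescaling [h = 2 f / n]
    turns the inequality into [h' >= c_n - 1 / x + (n^2 / 4) h^2 / x], where
    [x = 1 - 2 s] and [c_n = 3 (n - 2) / (2 (n - 1))].  Both [c_n] and
    [n^2 / 4] increase with [n], so a solution for [n] satisfies the inequality
    for [n = 19], with [c_19 = 17 / 12] ([rescaled_inequality]).

    For each [n] the quadratic form belongs to a Bessel equation of order [n / 2]
    in the variable [sqrt x], with a Neumann condition at [x = 1].  It takes
    negative values when [n sqrt (3 (n - 2) / (8 (n - 1)))] exceeds the first
    positive zero of the derivative of the Bessel function [J] of order [n / 2];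
    numerically this is 11.307 against 11.242 for [n = 19], but 10.694 against
    10.711 for [n = 18].  The ground state for [n = 19], which is this [J] up to
    scaling of its value and argument, is close to zero for small [x] and is
    well approximated by the cubic [x (4 x - 1) (3 - 2 x)] on [1/4 <= x <= 1].
    Its factor [x] cancels the pole [1 / x], so [Q] is a polynomial, and its zero
    at [x = 1/4], that is [s = 3/8], keeps the argument away from the singular
    end [s = 1/2].  What remains is to see that [Q (3/8) > Q 0]. *)

(** * Riccati inequalities *)

(** Picone's identity in differential form: the lower bound for [(phi^2 h - Q)']
    comes from completing the square in [h].  At [a], only continuity of [h] is
    asked for, so that functions with a one-sided derivative there qualify. *)
Lemma riccati_test_function (a b : R) (h dh p q phi dphi Q : R -> R) :
  a < b ->
  (forall s, a <= s <= b -> continuity_pt h s) ->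
  (forall s, a < s < b -> is_derive h s (dh s)) ->
  (forall s, a < s < b -> 0 < p s) ->
  (forall s, a < s < b -> q s + p s * h s ^ 2 <= dh s) ->
  (forall s, a <= s <= b -> is_derive phi s (dphi s)) ->
  (forall s, a <= s <= b ->
     is_derive Q s (q s * phi s ^ 2 - dphi s ^ 2 / p s)) ->
  h a = 0 -> phi b = 0 -> Q b <= Q a.
Proof.
intros Hab Hc Hd Hp Hric Hphi HQ Ha Hb.
set (G := fun s => phi s * phi s * h s - Q s).
set (dG := fun s => 2 * (phi s * dphi s) * h s + phi s ^ 2 * dh s
                    - (q s * phi s ^ 2 - dphi s ^ 2 / p s)).
assert (HGd : forall s, a < s < b -> is_derive G s (dG s)).
{ intros s Hs.
  assert (Hs' : a <= s <= b) by lra.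
  unfold G, dG.
  evar_last.
  - apply (is_derive_minus (fun t => phi t * phi t * h t) Q).
    + apply (is_derive_mult (fun t => phi t * phi t) h).
      * apply (is_derive_mult phi phi).
        -- exact (Hphi s Hs').
        -- exact (Hphi s Hs').
        -- exact Rmult_comm.
      * exact (Hd s Hs).
      * exact Rmult_comm.
    + exact (HQ s Hs').
  - unfold minus, plus, opp, mult; simpl; ring. }
assert (cont : forall g l s, is_derive g s l -> continuity_pt g s).
{ intros g l s Hg; apply derivable_continuous_pt.
  exists l; apply is_derive_Reals; exact Hg. }
assert (HGc : forall s, a <= s <= b -> continuity_pt G s).
{ intros s Hs; unfold G.
  apply (continuity_pt_minus (fun t => phi t * phi t * h t) Q).
  - apply (continuity_pt_mult (fun t => phi t * phi t) h).
    + apply (continuity_pt_mult phi phi); apply (cont _ (dphi s)), Hphi, Hs.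
    + exact (Hc s Hs).
  - exact (cont _ _ _ (HQ s Hs)). }
assert (HdG : forall s, a < s < b -> 0 <= dG s).
{ intros s Hs.
  assert (H1 : 0 <= phi s ^ 2 * (dh s - (q s + p s * h s ^ 2))).
  { apply Rmult_le_pos; [apply pow2_ge_0 | specialize (Hric s Hs); lra]. }
  assert (H2 : 0 <= p s * (phi s * h s + dphi s / p s) ^ 2).
  { apply Rmult_le_pos; [specialize (Hp s Hs); lra | apply pow2_ge_0]. }
  assert (E : dG s = phi s ^ 2 * (dh s - (q s + p s * h s ^ 2))
                     + p s * (phi s * h s + dphi s / p s) ^ 2).
  { unfold dG; field; specialize (Hp s Hs); lra. }
  lra. }
assert (Hmono : G a <= G b).
{ (* The mean value theorem may return an endpoint, where the sign of [dG] is
     not known; [Rabs] leaves [dG] unchanged inside and is nonnegative there. *)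
  destruct (MVT_gen G a b (fun s => Rabs (dG s))) as [c [_ Hc']].
  - rewrite Rmin_left, Rmax_right by lra; intros s Hs.
    rewrite Rabs_pos_eq by exact (HdG s Hs); exact (HGd s Hs).
  - rewrite Rmin_left, Rmax_right by lra; exact HGc.
  - assert (0 <= Rabs (dG c) * (b - a)).
    { apply Rmult_le_pos; [apply Rabs_pos | lra]. }
    lra. }
unfold G in Hmono; rewrite Ha, Hb in Hmono; lra.
Qed.

(** * Derivatives along an interval *)

(** Clamping the argument at [0] replaces the values of [f] to the left of the
    interval, so that one-sided continuity at [0] becomes continuity. *)
Lemma continuity_pt_clamped (f : R -> R) (b s : R) :
  0 <= s < b -> continue_in f (fun t => 0 <= t < b) s ->
  continuity_pt (fun t => f (Rmax 0 t)) s.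
Proof.
intros Hs Hf eps Heps.
destruct (Hf eps Heps) as [alp [Halp Hlim]].
exists (Rmin alp (b - s)); split; [apply Rmin_pos; lra |].
intros t [_ Ht]; simpl in Ht |- *; unfold Rdist in Ht |- *.
rewrite (Rmax_right 0 s) by lra.
pose proof (Rmin_l alp (b - s)); pose proof (Rmin_r alp (b - s)).
assert (Hz : Rabs (Rmax 0 t - s) <= Rabs (t - s)).
{ unfold Rmax; destruct (Rle_dec 0 t); unfold Rabs;
    repeat destruct Rcase_abs; lra. }
assert (Hz0 := Rmax_l 0 t).
set (z := Rmax 0 t) in *.
destruct (Req_dec z s) as [-> | Hne].
- rewrite Rminus_diag, Rabs_R0; exact Heps.
- apply (Hlim z); simpl; unfold Rdist; split; [| lra].
  pose proof (Rle_abs (z - s)).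
  repeat split; [lra | lra | exact (not_eq_sym Hne)].
Qed.

Lemma is_derive_clamped (f df : R -> R) (b s : R) :
  0 < s < b -> D_in f df (fun t => 0 <= t < b) s ->
  is_derive (fun t => f (Rmax 0 t)) s (df s).
Proof.
intros Hs Hf; apply is_derive_Reals; intros eps Heps.
destruct (Hf eps Heps) as [alp [Halp Hlim]].
assert (Hd : 0 < Rmin alp (Rmin s (b - s))) by (repeat apply Rmin_pos; lra).
exists (mkposreal _ Hd); simpl; intros k Hk0 Hk.
pose proof (Rmin_l alp (Rmin s (b - s))).
pose proof (Rmin_r alp (Rmin s (b - s))).
pose proof (Rmin_l s (b - s)); pose proof (Rmin_r s (b - s)).
pose proof (Rle_abs k); pose proof (Rle_abs (- k)) as Hk'.
rewrite Rabs_Ropp in Hk'.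
rewrite !Rmax_right by lra.
replace k with (s + k - s) at 2 by ring.
apply (Hlim (s + k)); simpl; unfold Rdist; split.
- repeat split; [lra | lra | intros E; apply Hk0; lra].
- replace (s + k - s) with k by ring; lra.
Qed.

(** * Reduction to n = 19 and the test function *)

(** The numbers [17/12] and [361/4] are the values at [N = 19] of
    [3 (N - 2) / (2 (N - 1))] and [N^2 / 4], both increasing in [N]. *)
Lemma rescaled_inequality (N s f d : R) :
  19 <= N -> s < 1/2 ->
  d >= N * (N - 4) / (4 * (N - 1)) - N / (2 * (1 - 2 * s)) * (2 * s - f ^ 2) ->
  17/12 - 1 / (1 - 2 * s) + 361/4 / (1 - 2 * s) * (2 / N * f) ^ 2
    <= 2 / N * d.
Proof.
intros HN Hs Hd.
assert (Hscaled : 2 / N * (N * (N - 4) / (4 * (N - 1))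
                   - N / (2 * (1 - 2 * s)) * (2 * s - f ^ 2)) <= 2 / N * d).
{ apply Rmult_le_compat_l; [| lra].
  apply Rlt_le, Rdiv_lt_0_compat; lra. }
refine (Rle_trans _ _ _ _ Hscaled).
assert (Hdiff : 2 / N * (N * (N - 4) / (4 * (N - 1))
                 - N / (2 * (1 - 2 * s)) * (2 * s - f ^ 2))
                - (17/12 - 1 / (1 - 2 * s)
                   + 361/4 / (1 - 2 * s) * (2 / N * f) ^ 2)
              = (N - 19) / (12 * (N - 1))
                + (N - 19) * (N + 19) / N ^ 2 * (f ^ 2 / (1 - 2 * s))).
{ field; lra. }
assert (H1 : 0 <= (N - 19) / (12 * (N - 1))).
{ apply Rdiv_le_0_compat; lra. }
assert (H2 : 0 <= (N - 19) * (N + 19) / N ^ 2).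
{ apply Rdiv_le_0_compat; [apply Rmult_le_pos; lra | apply pow_lt; lra]. }
assert (H3 : 0 <= f ^ 2 / (1 - 2 * s)).
{ apply Rdiv_le_0_compat; [apply pow2_ge_0 | lra]. }
pose proof (Rmult_le_pos _ _ H2 H3); lra.
Qed.

(** [x (4 x - 1) (3 - 2 x)] at [x = 1 - 2 s]. *)
Definition test_function (s : R) : R := (1 - 2 * s) * (3 - 8 * s) * (1 + 4 * s).

(** Antiderivative of [q phi^2 - phi'^2 / p] for [phi] the test function and
    [p], [q] the coefficients of [rescaled_inequality]; [4332 = 12 * 19^2] clears
    the denominators of these coefficients. *)
Definition quadratic_form_primitive (s : R) : R :=
  (16053 * s - 57306 * s ^ 2 - 717580 / 3 * s ^ 3 + 1234472 * s ^ 4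
   - 3124416 / 5 * s ^ 5 - 9505280 / 3 * s ^ 6 + 25137152 / 7 * s ^ 7) / 4332.

Lemma is_derive_test_function (s : R) :
  is_derive test_function s (-2 - 80 * s + 192 * s ^ 2).
Proof. unfold test_function; auto_derive; [exact I | ring]. Qed.

Lemma is_derive_quadratic_form_primitive (s : R) :
  s < 1/2 ->
  is_derive quadratic_form_primitive s
    ((17/12 - 1 / (1 - 2 * s)) * test_function s ^ 2
     - (-2 - 80 * s + 192 * s ^ 2) ^ 2 / (361/4 / (1 - 2 * s))).
Proof.
intros Hs; unfold quadratic_form_primitive, test_function.
auto_derive; [exact I | field; lra].
Qed.

Lemma quadratic_form_primitive_increases :
  quadratic_form_primitive 0 < quadratic_form_primitive (3/8).
Proof. unfold quadratic_form_primitive; lra. Qed.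

(** * Nonexistence *)

Theorem proposition3p1 :
  forall n : nat, (19 <= n)%nat ->
  ~ exists f df : R -> R,
      C1_on half_open_half f df /\
      f 0 = 0 /\
      (forall s : R, half_open_half s ->
         df s >= lambda n - INR n / (2 * (1 - 2 * s)) * (2 * s - (f s) ^ 2)).
Proof.
intros n Hn [f [df [[Hf _] [Hf0 Hineq]]]].
assert (HN : 19 <= INR n).
{ apply le_INR in Hn; replace 19 with (INR 19) by (simpl; ring); exact Hn. }
set (h := fun s => 2 / INR n * f (Rmax 0 s)).
apply (Rlt_not_le _ _ quadratic_form_primitive_increases).
apply (riccati_test_function 0 (3/8) h (fun s => 2 / INR n * df s)
         (fun s => 361/4 / (1 - 2 * s)) (fun s => 17/12 - 1 / (1 - 2 * s))
         test_function (fun s => -2 - 80 * s + 192 * s ^ 2)).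
- lra.
- intros s Hs; unfold h.
  assert (Hs' : half_open_half s) by (unfold half_open_half; lra).
  apply (continuity_pt_scal (fun t => f (Rmax 0 t))).
  apply (continuity_pt_clamped f (1/2)); [lra |].
  exact (cont_deriv _ _ _ _ (Hf s Hs')).
- intros s Hs; unfold h.
  assert (Hs' : half_open_half s) by (unfold half_open_half; lra).
  apply (is_derive_scal (fun t => f (Rmax 0 t))).
  apply (is_derive_clamped f df (1/2)); [lra | exact (Hf s Hs')].
- intros s Hs; apply Rdiv_lt_0_compat; lra.
- intros s Hs; unfold h; rewrite Rmax_right by lra.
  apply rescaled_inequality; [exact HN | lra |].
  apply Hineq; unfold half_open_half; lra.
- intros s _; exact (is_derive_test_function s).
- intros s Hs; apply is_derive_quadratic_form_primitive; lra.
- unfold h; rewrite Rmax_right, Hf0 by lra; ring.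
- unfold test_function; lra.
Qed.
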